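(* Let the Fine numbers $f_n$ be defined by $f_0=1$, $f_1=0$ and $2(n + 1)f_n = (7n-5)f_{n-1} + 2(2n-1)f_{n-2}$ for $n\geq 2$. The sequence $\{f_n\}_{n\geq 5}$ is ratio log-concave, and the sequence $\{\sqrt[n]{f_n}\}_{n\geq 2}$ is strictly log-concave.
   Context: A sequence $(x_n)_{n\ge m}$ of positive reals is log-concave if $x_n^2\ge x_{n-1}x_{n+1}$ for all $n\ge m+1$, strictly log-concave if the inequality is strict. A sequence $(a_n)_{n\ge m}$ of positive reals is ratio log-concave if $(a_{n+1}/a_n)_{n\ge m}$ is log-concave. *)

(* Defs.v *)
From Stdlib Require Import Reals Lra Lia.
Open Scope R_scope.

Definition positive_from (m : nat) (x : nat -> R) : Prop :=
  forall n : nat, (m <= n)%nat -> 0 < x n.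

Definition log_concave (m : nat) (x : nat -> R) : Prop :=
  positive_from m x /\
  forall n : nat, (m + 1 <= n)%nat -> x n ^ 2 >= x (n - 1)%nat * x (n + 1)%nat.

Definition strictly_log_concave (m : nat) (x : nat -> R) : Prop :=
  positive_from m x /\
  forall n : nat, (m + 1 <= n)%nat -> x n ^ 2 > x (n - 1)%nat * x (n + 1)%nat.

Definition ratio_log_concave (m : nat) (a : nat -> R) : Prop :=
  positive_from m a /\ log_concave m (fun n => a (n + 1)%nat / a n).

(* [Rpower x y] is [exp (y * ln x)]: this is the n-th root only for [0 < x] and
   [n <> 0]. *)
Definition nth_root (n : nat) (x : R) : R := Rpower x (/ INR n).

Definition is_fine (f : nat -> R) : Prop :=
  f 0%nat = 1 /\ f 1%nat = 0 /\
  forall n : nat, (2 <= n)%nat ->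
    2 * (INR n + 1) * f n =
      (7 * INR n - 5) * f (n - 1)%nat + 2 * (2 * INR n - 1) * f (n - 2)%nat.

(* [fine_pair n] is the pair of the n-th and (n+1)-st Fine numbers. *)
Fixpoint fine_pair (n : nat) : R * R :=
  match n with
  | O => (1, 0)
  | S k =>
      let (a, b) := fine_pair k in
      let N := INR (k + 2) in
      (b, ((7 * N - 5) * b + 2 * (2 * N - 1) * a) / (2 * (N + 1)))
  end.

Definition fine (n : nat) : R := fst (fine_pair n).

Lemma fine_is_fine : is_fine fine.
Proof.
split; [reflexivity | split; [reflexivity |]].
intros n Hn.
destruct n as [|[|k]]; [lia | lia |].
replace (S (S k) - 1)%nat with (S k) by lia.
replace (S (S k) - 2)%nat with k by lia.
unfold fine; cbn [fine_pair].
destruct (fine_pair k) as [a b]; cbn [fst snd].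
replace (k + 2)%nat with (S (S k)) by lia.
pose proof (pos_INR (S (S k))).
field; lra.
Qed.

Lemma is_fine_unique (f g : nat -> R) :
  is_fine f -> is_fine g -> forall n, f n = g n.
Proof.
intros [f0 [f1 fr]] [g0 [g1 gr]] n.
enough (f n = g n /\ f (S n) = g (S n)) by tauto.
induction n as [|n [IH1 IH2]]; [split; congruence | split; [exact IH2 |]].
assert (Hf := fr (S (S n)) ltac:(lia)).
assert (Hg := gr (S (S n)) ltac:(lia)).
replace (S (S n) - 1)%nat with (S n) in Hf, Hg by lia.
replace (S (S n) - 2)%nat with n in Hf, Hg by lia.
rewrite IH1, IH2, <- Hg in Hf.
apply Rmult_eq_reg_l in Hf; [exact Hf |].
pose proof (pos_INR (S (S n))); lra.
Qed.

(* Main.v *)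
Require Import Defs.
From Stdlib Require Import Reals Lra Lia.
Open Scope R_scope.

(** Write [r_n = f_(n+1) / f_n].  The recurrence expresses [r_(n-1)] and
    [r_(n+1)] through [r_n], so [r_n^2 >= r_(n-1) r_(n+1)] is a quartic
    inequality in [r_n], which holds above an explicit rational lower bound
    for [r_n].  Since [r_n] is a decreasing function of [r_(n-1)], that bound
    is proved by induction together with an upper bound.

    For the roots let [D n] be [root_defect f n], that is,
    [n (n+1) ln r_(n-1) - n (n-1) ln r_n - 2 ln f_n].
    Strict log-concavity of the roots at [n] says [D n > 0], and
    [D (n+1) - D n = n (n+1) (2 ln r_n - ln r_(n-1) - ln r_(n+1)) >= 0]
    by ratio log-concavity, so only finitely many [n] have to be checked. *)

(* The two bounds are [4 - 6 / (x + 19/9 + d / x)] with [d = 1/9] and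
   [d = 1/3]: asymptotically [r_n] is of this form with [d] near [0.247]. *)
Definition lower_num (x : R) : R := 36 * x ^ 2 + 22 * x + 4.
Definition lower_den (x : R) : R := 9 * x ^ 2 + 19 * x + 1.
Definition upper_num (x : R) : R := 36 * x ^ 2 + 22 * x + 12.
Definition upper_den (x : R) : R := 9 * x ^ 2 + 19 * x + 3.

(** * Polynomial inequalities behind the ratio bounds and the quartic *)

Ltac positivity :=
  repeat match goal with
  | |- 0 <= _ + _ => apply Rplus_le_le_0_compat
  | |- 0 <= _ * _ => apply Rmult_le_pos
  | |- 0 <= _ ^ _ => apply pow_le
  end; try assumption; try lra.

(** Works when every coefficient of the expanded polynomial is nonnegative; the substitution
    [x = m + 6] before each call achieves this. *)
Ltac poly_pos :=
  match goal with |- 0 <= ?e => ring_simplify e end; positivity.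

Lemma lower_den_pos (x : R) : 0 <= x -> 0 < lower_den x.
Proof. unfold lower_den; nra. Qed.

Lemma upper_den_pos (x : R) : 0 <= x -> 0 < upper_den x.
Proof. unfold upper_den; nra. Qed.

Lemma lower_num_pos (x : R) : 0 <= x -> 0 < lower_num x.
Proof. unfold lower_num; nra. Qed.

Lemma upper_num_pos (x : R) : 0 <= x -> 0 < upper_num x.
Proof. unfold upper_num; nra. Qed.

(** For consecutive terms [a], [b], [c], an upper bound on [b / a] bounds [a / b] from below, and
    with it [c / b], by the recurrence. *)
Lemma lower_bound_step (x a b c : R) :
  6 <= x -> 0 < b ->
  upper_den x * b <= upper_num x * a ->
  2 * (x + 3) * c = (7 * x + 9) * b + 2 * (2 * x + 3) * a ->
  lower_num (x + 1) * b <= lower_den (x + 1) * c.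
Proof.
intros Hx Hb Hab Hc.
assert (Hn := upper_num_pos x ltac:(lra)).
assert (Hd := lower_den_pos (x + 1) ltac:(lra)).
set (k := 2 * (x + 3) * upper_num x).
assert (Hk : 0 < k) by (unfold k; apply Rmult_lt_0_compat; lra).
apply (Rmult_le_reg_l k); [exact Hk |].
assert (Ha : 0 <= 2 * (2 * x + 3) * lower_den (x + 1) *
                  (upper_num x * a - upper_den x * b)).
{ repeat apply Rmult_le_pos; lra. }
(* After scaling by [k], the difference of the two sides is the expression in [Ha] plus [b] times
   this one. *)
assert (Hp : 0 <= upper_num x * lower_den (x + 1) * (7 * x + 9)
                  + 2 * (2 * x + 3) * lower_den (x + 1) * upper_den x
                  - k * lower_num (x + 1)).
{ unfold k, upper_num, upper_den, lower_num, lower_den.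
  assert (Hm : 0 <= x - 6) by lra.
  set (m := x - 6) in Hm. replace x with (m + 6) by (unfold m; ring).
  poly_pos. }
apply (Rmult_le_pos _ b) in Hp; [| lra].
replace (k * (lower_den (x + 1) * c))
  with (upper_num x * lower_den (x + 1) * (2 * (x + 3) * c))
  by (unfold k; ring).
rewrite Hc. lra.
Qed.

Lemma upper_bound_step (x a b c : R) :
  6 <= x -> 0 < b ->
  lower_num x * a <= lower_den x * b ->
  2 * (x + 3) * c = (7 * x + 9) * b + 2 * (2 * x + 3) * a ->
  upper_den (x + 1) * c <= upper_num (x + 1) * b.
Proof.
intros Hx Hb Hab Hc.
assert (Hn := lower_num_pos x ltac:(lra)).
assert (Hd := upper_den_pos (x + 1) ltac:(lra)).
set (k := 2 * (x + 3) * lower_num x).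
assert (Hk : 0 < k) by (unfold k; apply Rmult_lt_0_compat; lra).
apply (Rmult_le_reg_l k); [exact Hk |].
assert (Ha : 0 <= 2 * (2 * x + 3) * upper_den (x + 1) *
                  (lower_den x * b - lower_num x * a)).
{ repeat apply Rmult_le_pos; lra. }
assert (Hp : 0 <= k * upper_num (x + 1)
                  - lower_num x * upper_den (x + 1) * (7 * x + 9)
                  - 2 * (2 * x + 3) * upper_den (x + 1) * lower_den x).
{ unfold k, upper_num, upper_den, lower_num, lower_den.
  assert (Hm : 0 <= x - 6) by lra.
  set (m := x - 6) in Hm. replace x with (m + 6) by (unfold m; ring).
  poly_pos. }
apply (Rmult_le_pos _ b) in Hp; [| lra].
replace (k * (upper_den (x + 1) * c))
  with (lower_num x * upper_den (x + 1) * (2 * (x + 3) * c))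
  by (unfold k; ring).
rewrite Hc. lra.
Qed.

(* For [b = f_n] and [c = f_(n+1)], the recurrence turns this into a positive
   multiple of [c ^ 3 * f_(n-1) - b ^ 3 * f_(n+2)]. *)
Definition ratio_quartic (x b c : R) : R :=
  (x + 3) * (2 * (x + 2) * c - (7 * x + 2) * b) * c ^ 3
  - (2 * x + 1) * ((7 * x + 9) * c + 2 * (2 * x + 3) * b) * b ^ 3.

Lemma ratio_quartic_nonneg (x b c : R) :
  6 <= x -> 0 < b -> lower_num x * b <= lower_den x * c ->
  0 <= ratio_quartic x b c.
Proof.
intros Hx Hb Hbc.
assert (Hd := lower_den_pos x ltac:(lra)).
(* The quartic is homogeneous in [b] and [c], so these can be rescaled to [lower_den x] and
   [lower_num x + s], where [s] is the excess over the lower bound. The result expands with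
   nonnegative coefficients in [m] and [s]. *)
set (s := lower_den x * c / b - lower_num x).
assert (Hs : 0 <= s).
{ apply (Rmult_le_reg_r b); [exact Hb |].
  replace (s * b) with (lower_den x * c - lower_num x * b)
    by (unfold s; field; lra).
  lra. }
assert (E : ratio_quartic x b c =
  (b / lower_den x) ^ 4 * ratio_quartic x (lower_den x) (lower_num x + s)).
{ unfold ratio_quartic, s. field. split; lra. }
rewrite E. apply Rmult_le_pos.
{ apply pow_le, Rlt_le, Rdiv_lt_0_compat; lra. }
clearbody s; clear - Hx Hs.
unfold ratio_quartic, lower_num, lower_den.
assert (Hm : 0 <= x - 6) by lra.
set (m := x - 6) in Hm. replace x with (m + 6) by (unfold m; ring).
poly_pos.
Qed.

(** For consecutive positive terms this is [(c / b) ^ 2 >= b / a * (d / c)] cleared of denominators;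
    the recurrences eliminate [a] and [d]. *)
Lemma cube_ratio_inequality (x a b c d : R) :
  6 <= x -> 0 < b -> lower_num x * b <= lower_den x * c ->
  2 * (x + 2) * c = (7 * x + 2) * b + 2 * (2 * x + 1) * a ->
  2 * (x + 3) * d = (7 * x + 9) * c + 2 * (2 * x + 3) * b ->
  b ^ 3 * d <= c ^ 3 * a.
Proof.
intros Hx Hb Hbc Ha Hd.
assert (HQ := ratio_quartic_nonneg x b c Hx Hb Hbc).
assert (E : ratio_quartic x b c =
  2 * (x + 3) * (2 * x + 1) * (c ^ 3 * a - b ^ 3 * d)).
{ unfold ratio_quartic. rewrite <- Hd, Ha. ring. }
rewrite E in HQ.
assert (0 < 2 * (x + 3) * (2 * x + 1)) by nra.
nra.
Qed.

(** * Fine numbers: positivity, ratio bounds and ratio log-concavity *)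

Section Fine.

Variable f : nat -> R.
Hypothesis hf : is_fine f.

Lemma fine_rec (n : nat) :
  2 * (INR n + 3) * f (n + 2)%nat =
    (7 * INR n + 9) * f (n + 1)%nat + 2 * (2 * INR n + 3) * f n.
Proof.
destruct hf as [_ [_ H]].
specialize (H (n + 2)%nat ltac:(lia)).
replace (n + 2 - 1)%nat with (n + 1)%nat in H by lia.
replace (n + 2 - 2)%nat with n in H by lia.
rewrite plus_INR in H; simpl (INR 2) in H.
lra.
Qed.

Lemma fine_values :
  f 2%nat = 1 /\ f 3%nat = 2 /\ f 4%nat = 6 /\ f 5%nat = 18 /\
  f 6%nat = 57 /\ f 7%nat = 186.
Proof.
destruct hf as [H0 [H1 _]].
assert (H2 := fine_rec 0); assert (H3 := fine_rec 1);
assert (H4 := fine_rec 2); assert (H5 := fine_rec 3);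
assert (H6 := fine_rec 4); assert (H7 := fine_rec 5).
simpl in H2, H3, H4, H5, H6, H7.
repeat split; lra.
Qed.

(** In the shifted recurrence all coefficients are positive, so positivity spreads from [f 2] and
    [f 3]. *)
Lemma fine_pos : positive_from 2 f.
Proof.
destruct fine_values as [H2 [H3 _]].
enough (H : forall n, 0 < f (n + 2)%nat /\ 0 < f (n + 3)%nat).
{ intros n Hn. replace n with (n - 2 + 2)%nat by lia. apply H. }
induction n as [|n [IH1 IH2]].
{ simpl; lra. }
replace (S n + 2)%nat with (n + 3)%nat by lia.
split; [exact IH2 |].
assert (H := fine_rec (n + 2)).
replace (n + 2 + 1)%nat with (n + 3)%nat in H by lia.
replace (n + 2 + 2)%nat with (S n + 3)%nat in H by lia.
assert (Hn := pos_INR (n + 2)).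
apply (Rmult_lt_reg_l (2 * (INR (n + 2) + 3))); [lra |].
rewrite H, Rmult_0_r.
apply Rplus_lt_0_compat; apply Rmult_lt_0_compat; lra.
Qed.

Lemma fine_ratio_bounds (n : nat) : (6 <= n)%nat ->
  lower_num (INR n) * f n <= lower_den (INR n) * f (n + 1)%nat /\
  upper_den (INR n) * f (n + 1)%nat <= upper_num (INR n) * f n.
Proof.
induction 1 as [|n Hn [IHl IHu]].
(* The induction cannot start at 5: the upper bound fails there, as [323 * 57 > 1022 * 18]. *)
{ destruct fine_values as [_ [_ [_ [_ [H6 H7]]]]].
  simpl (6 + 1)%nat. rewrite H6, H7.
  unfold lower_num, lower_den, upper_num, upper_den; simpl; lra. }
assert (Hx : 6 <= INR n) by (apply (le_INR 6) in Hn; simpl in Hn; lra).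
assert (Hb : 0 < f (n + 1)%nat) by (apply fine_pos; lia).
replace (S n + 1)%nat with (n + 2)%nat by lia.
replace (f (S n)) with (f (n + 1)%nat) by (f_equal; lia).
rewrite S_INR.
split.
- apply (lower_bound_step _ (f n)); auto using fine_rec.
- apply (upper_bound_step _ (f n)); auto using fine_rec.
Qed.

Lemma fine_ratio_log_concave : ratio_log_concave 5 f.
Proof.
assert (Hpos : positive_from 5 f) by (intros n Hn; apply fine_pos; lia).
split; [exact Hpos | split].
{ intros n Hn; apply Rdiv_lt_0_compat; apply Hpos; lia. }
intros n Hn; simpl in Hn.
replace (n - 1 + 1)%nat with n by lia.
replace (n + 1 + 1)%nat with (n + 2)%nat by lia.
assert (Ha : 0 < f (n - 1)%nat) by (apply Hpos; lia).
assert (Hb : 0 < f n) by (apply Hpos; lia).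
assert (Hc : 0 < f (n + 1)%nat) by (apply Hpos; lia).
assert (Hx : 6 <= INR n) by (apply (le_INR 6) in Hn; simpl in Hn; lra).
assert (Hrec := fine_rec (n - 1)).
replace (n - 1 + 2)%nat with (n + 1)%nat in Hrec by lia.
replace (n - 1 + 1)%nat with n in Hrec by lia.
rewrite (minus_INR n 1) in Hrec by lia; simpl (INR 1) in Hrec.
assert (H : f n ^ 3 * f (n + 2)%nat <= f (n + 1)%nat ^ 3 * f (n - 1)%nat).
{ apply (cube_ratio_inequality (INR n)); auto using fine_rec.
  - apply fine_ratio_bounds; lia.
  - lra. }
set (a := f (n - 1)%nat) in *; set (b := f n) in *;
set (c := f (n + 1)%nat) in *; set (d := f (n + 2)%nat) in *.
apply Rminus_ge.
replace ((c / b) ^ 2 - b / a * (d / c))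
  with ((c ^ 3 * a - b ^ 3 * d) / (a * b ^ 2 * c)) by (field; lra).
apply Rle_ge, Rmult_le_pos; [lra |].
apply Rlt_le, Rinv_0_lt_compat.
repeat apply Rmult_lt_0_compat; try apply pow_lt; lra.
Qed.

End Fine.

(** * Strict log-concavity of the roots *)

(** The logarithm of [x_n ^ 2 / (x_(n-1) * x_(n+1))] for the roots [x_n], multiplied by
    [n (n-1) (n+1)] to clear denominators. *)
Definition root_defect (f : nat -> R) (n : nat) : R :=
  2 * (INR n - 1) * (INR n + 1) * ln (f n)
  - INR n * (INR n + 1) * ln (f (n - 1)%nat)
  - INR n * (INR n - 1) * ln (f (n + 1)%nat).

Lemma root_log_concave_at (f : nat -> R) (n : nat) :
  (2 <= n)%nat -> 0 < root_defect f n ->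
  nth_root n (f n) ^ 2 >
  nth_root (n - 1) (f (n - 1)%nat) * nth_root (n + 1) (f (n + 1)%nat).
Proof.
intros Hn HD.
assert (Hx : 2 <= INR n) by (apply (le_INR 2) in Hn; simpl in Hn; lra).
unfold nth_root, Rpower; simpl pow.
rewrite Rmult_1_r, <- !exp_plus.
apply exp_increasing, Rlt_0_minus.
rewrite minus_INR, plus_INR by lia; simpl (INR 1).
match goal with |- 0 < ?e => replace e with
  (root_defect f n / (INR n * (INR n - 1) * (INR n + 1)))
  by (unfold root_defect; field; lra) end.
apply Rdiv_lt_0_compat; [exact HD |].
repeat apply Rmult_lt_0_compat; lra.
Qed.

Lemma ln_quotient (x y : R) : 0 < x -> 0 < y -> ln (x / y) = ln x - ln y.
Proof.
intros Hx Hy; unfold Rdiv.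
rewrite ln_mult, ln_Rinv; auto using Rinv_0_lt_compat.
Qed.

Lemma root_defect_nondecreasing (m : nat) (f : nat -> R) :
  ratio_log_concave m f -> forall n, (m + 1 <= n)%nat ->
  root_defect f n <= root_defect f (n + 1).
Proof.
intros [Hpos [_ H]] n Hn.
specialize (H n Hn); simpl in H.
replace (n - 1 + 1)%nat with n in H by lia.
assert (Ha : 0 < f (n - 1)%nat) by (apply Hpos; lia).
assert (Hb : 0 < f n) by (apply Hpos; lia).
assert (Hc : 0 < f (n + 1)%nat) by (apply Hpos; lia).
assert (Hd : 0 < f (n + 1 + 1)%nat) by (apply Hpos; lia).
unfold root_defect.
replace (n + 1 - 1)%nat with n by lia.
rewrite plus_INR; simpl (INR 1).
set (a := f (n - 1)%nat) in *; set (b := f n) in *;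
set (c := f (n + 1)%nat) in *; set (d := f (n + 1 + 1)%nat) in *.
assert (Hln : ln (b / a * (d / c)) <= ln (c / b * (c / b * 1))).
{ apply Rge_le in H. destruct H as [H | H].
  - left; apply ln_increasing; [| exact H].
    apply Rmult_lt_0_compat; apply Rdiv_lt_0_compat; lra.
  - right; f_equal; exact H. }
rewrite Rmult_1_r in Hln.
rewrite !ln_mult in Hln by (apply Rdiv_lt_0_compat; lra).
rewrite !ln_quotient in Hln by lra.
assert (Hx := pos_INR n).
(* The last factor is [2 ln r_n - ln r_(n-1) - ln r_(n+1)], and the product is exactly the increment
   of [root_defect]. *)
assert (HE : 0 <= INR n * (INR n + 1) * (3 * ln c + ln a - 3 * ln b - ln d)).
{ repeat apply Rmult_le_pos; lra. }
lra.
Qed.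

(** Reduces a comparison of logarithms to one of integer powers, which [eq_refl] settles by
    computation. *)
Lemma ln_weighted_lt (p q r : nat) (x y z : Z) :
  (0 < x)%Z -> (0 < y)%Z -> (0 < z)%Z ->
  (x ^ Z.of_nat p * z ^ Z.of_nat r < y ^ Z.of_nat q)%Z ->
  INR p * ln (IZR x) + INR r * ln (IZR z) < INR q * ln (IZR y).
Proof.
intros Hx%IZR_lt Hy%IZR_lt Hz%IZR_lt H%IZR_lt.
rewrite mult_IZR, <- !pow_IZR in H.
rewrite <- !ln_pow, <- ln_mult by auto using pow_lt.
apply ln_increasing; [| exact H].
apply Rmult_lt_0_compat; auto using pow_lt.
Qed.

Lemma fine_root_defect_pos (f : nat -> R) (n : nat) :
  is_fine f -> (3 <= n)%nat -> 0 < root_defect f n.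
Proof.
intros hf Hn.
destruct (fine_values f hf) as [H2 [H3 [H4 [H5 [H6 H7]]]]].
assert (H : n = 3%nat \/ n = 4%nat \/ n = 5%nat \/ (6 <= n)%nat) by lia.
destruct H as [-> | [-> | [-> | H]]].
- unfold root_defect; simpl (3 - 1)%nat; simpl (3 + 1)%nat.
  rewrite H2, H3, H4.
  (* Here and in the other cases the weights are half the coefficients in [root_defect]. *)
  assert (L := ln_weighted_lt 6 8 3 1 2 6 eq_refl eq_refl eq_refl eq_refl).
  simpl in L |- *. lra.
- unfold root_defect; simpl (4 - 1)%nat; simpl (4 + 1)%nat.
  rewrite H3, H4, H5.
  assert (L := ln_weighted_lt 10 15 6 2 6 18 eq_refl eq_refl eq_refl eq_refl).
  simpl in L |- *. lra.
- unfold root_defect; simpl (5 - 1)%nat; simpl (5 + 1)%nat.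
  rewrite H4, H5, H6.
  assert (L := ln_weighted_lt 15 24 10 6 18 57 eq_refl eq_refl eq_refl eq_refl).
  simpl in L |- *. lra.
(* Ratio log-concavity from 5 gives monotonicity only from [n = 6] on, hence the separate checks
   below 6. *)
- clear Hn; induction H as [|n Hn IH].
  + unfold root_defect; simpl (6 - 1)%nat; simpl (6 + 1)%nat.
    rewrite H5, H6, H7.
    assert (L := ln_weighted_lt 21 35 15 18 57 186
                   eq_refl eq_refl eq_refl eq_refl).
    simpl in L |- *. lra.
  + apply (Rlt_le_trans _ _ _ IH).
    replace (S n) with (n + 1)%nat by lia.
    apply (root_defect_nondecreasing 5); [apply fine_ratio_log_concave, hf | lia].
Qed.

Theorem theorem4p4 (f : nat -> R) (hf : is_fine f) :
  ratio_log_concave 5 f /\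
  strictly_log_concave 2 (fun n => nth_root n (f n)).
Proof.
split; [exact (fine_ratio_log_concave f hf) | split].
- intros n _; apply exp_pos.
- intros n Hn; apply root_log_concave_at; [lia |].
  apply fine_root_defect_pos; [exact hf | lia].
Qed.
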